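(* Let $A|H$ and $B|K$ be two conditional events (with $H\neq\emptyset$, $K\neq\emptyset$). Then $$B|K=(A|H)\wedge(B|K)+(\overline{A}|H)\wedge(B|K),$$ as an equality of random quantities (i.e., the two sides take the same value in every possible case, including when $H\vee K$ is false), where the previsions entering the definitions of these quantities form a coherent assessment.
   Context: Events. Events are two-valued (true/false) logical entities, i.e. elements of a Boolean algebra (equivalently, subsets of a set $\Omega$); $\Omega$ is the sure event, $\emptyset$ the impossible event, $AB=A\wedge B$ is conjunction, $A\vee B$ disjunction, $\overline{A}$ negation. An event is identified with its $0/1$ indicator. No logical independence of $A,B,H,K$ is assumed. Conditional random quantities. For a random quantity $X$ with finitely many values, an event $H\ne\emptyset$ and the prevision $\mu=\mathbb{P}(X|H)$, the conditional random quantity $X|H$ is identified with the random quantity $XH+\mu\overline{H}$. In particular, the conditional event $A|H$ with $x=P(A|H)$ is $AH+x\overline{H}$, and its negation is $\overline{A}|H=1-A|H$, with $P(\overline{A}|H)=1-x$. Conjunction. Given conditional events $A|H$, $B|K$ with $P(A|H)=x$, $P(B|K)=y$, their conjunction is the conditional random quantity $(A|H)\wedge(B|K)=Z\,|\,(H\vee K)$, where $Z=\min\{A|H,B|K\}$. Explicitly, with $z_1=\mathbb{P}[(A|H)\wedge(B|K)]$, $$(A|H)\wedge(B|K)=AHBK+x\,\overline{H}BK+y\,AH\overline{K}+z_1\,\overline{H}\,\overline{K},$$ and likewise, with $z_2=\mathbb{P}[(\overline{A}|H)\wedge(B|K)]$, $$(\overline{A}|H)\wedge(B|K)=\overline{A}HBK+(1-x)\,\overline{H}BK+y\,\overline{A}H\overline{K}+z_2\,\overline{H}\,\overline{K}.$$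 Coherence. A prevision assessment $(\mu_1,\dots,\mu_n)$ on conditional random quantities $X_1|H_1,\dots,X_n|H_n$ is coherent if and only if, for every nonempty $J\subseteq\{1,\dots,n\}$ and all real $s_i$ ($i\in J$), the random gain $G=\sum_{i\in J}s_iH_i(X_i-\mu_i)$, restricted to $\bigvee_{i\in J}H_i$, satisfies $\min G\le 0\le\max G$. Standing assumption: the assessment $(x,y,z_1,z_2)$ on $\bigl(A|H,\;B|K,\;(A|H)\wedge(B|K),\;(\overline{A}|H)\wedge(B|K)\bigr)$ is coherent, where the conditioning events of these four quantities are $H$, $K$, $H\vee K$, $H\vee K$, respectively. *)

(* Defs.v *)
From mathcomp Require Import all_boot all_order all_algebra.
From mathcomp Require Import all_classical all_reals.
From mathcomp Require Import numfun.

Set Implicit Arguments.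
Unset Strict Implicit.
Unset Printing Implicit Defensive.

Import Order.TTheory GRing.Theory Num.Theory.
Local Open Scope classical_set_scope.
Local Open Scope ring_scope.

(* Events are subsets of the sure event [Omega], identified with their
   indicators [\1_A]; random quantities are functions [Omega -> R]. *)

(* X|H, identified with X H + mu (not H), where mu is the prevision of X|H. *)
Definition cond_rq (R : realType) (Omega : Type)
    (X : Omega -> R) (H : set Omega) (mu : R) : Omega -> R :=
  fun w => X w * \1_H w + mu * \1_(~` H) w.

(* A|H with P(A|H) = x.  Its negation 1 - A|H, of probability 1 - x, is
   [cond_event (~` A) H (1 - x)]. *)
Definition cond_event (R : realType) (Omega : Type)
    (A H : set Omega) (x : R) : Omega -> R :=
  cond_rq \1_A H x.

Definition min_rq (R : realType) (Omega : Type)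
    (A H : set Omega) (x : R) (B K : set Omega) (y : R) : Omega -> R :=
  fun w => Num.min (cond_event A H x w) (cond_event B K y w).

(* (A|H) /\ (B|K) = min{A|H, B|K} | (H \/ K), with prevision z. *)
Definition conj_rq (R : realType) (Omega : Type)
    (A H : set Omega) (x : R) (B K : set Omega) (y : R) (z : R) : Omega -> R :=
  cond_rq (min_rq A H x B K y) (H `|` K) z.

Definition is_min (R : realType) (S : set R) (m : R) : Prop :=
  S m /\ lbound S m.

Definition is_max (R : realType) (S : set R) (M : R) : Prop :=
  S M /\ ubound S M.

Definition gain (R : realType) (Omega : Type) (n : nat)
    (X : 'I_n -> Omega -> R) (H : 'I_n -> set Omega) (mu : 'I_n -> R)
    (J : {set 'I_n}) (s : 'I_n -> R) : Omega -> R :=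
  fun w => \sum_(i in J) s i * \1_(H i) w * (X i w - mu i).

(* Coherence of the prevision assessment mu on the X_i|H_i.  The minimum and
   the maximum are attained whenever the X_i take finitely many values and the
   H_i are nonempty, which is the intended domain of this definition. *)
Definition coherent (R : realType) (Omega : Type) (n : nat)
    (X : 'I_n -> Omega -> R) (H : 'I_n -> set Omega) (mu : 'I_n -> R) : Prop :=
  forall (J : {set 'I_n}) (s : 'I_n -> R), (exists i, i \in J) ->
  exists m M : R,
    [/\ is_min (gain X H mu J s @` \bigcup_(i in [set` J]) H i) m,
        is_max (gain X H mu J s @` \bigcup_(i in [set` J]) H i) M
      & m <= 0 <= M].

(* Main.v *)
Require Import Defs.
From mathcomp Require Import all_boot all_order all_algebra.
From mathcomp Require Import all_classical all_reals.
From mathcomp Require Import numfun.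
From mathcomp Require Import lra.

(** On [H `|` K] the identity is pointwise and uses only that the
    probabilities [x] and [y] lie in [0, 1]: writing [a] and [b] for the values
    of [A|H] and [B|K], the claim is [min a b + min (1 - a) b = b]
    ([minr_split]), which holds because at least one of [a], [b] is an
    indicator value, 0 or 1, while the other is in [0, 1].

    Outside [H `|` K] the claim is the relation [y = z1 + z2] between
    previsions, which only coherence can give.  Bet 1 on each of the two
    conjunctions and -1 on [B|K]: by the pointwise identity the gain is the
    constant [y - (z1 + z2)] on [H `|` K], and a constant gain in a coherent
    assessment vanishes ([coherent_cst_gain]). *)

Set Implicit Arguments.
Unset Strict Implicit.

Import Order.TTheory GRing.Theory Num.Theory.
Local Open Scope classical_set_scope.
Local Open Scope ring_scope.

(** * Conditional random quantities *)

Lemma cond_rq_in (R : realType) (Omega : Type) (X : Omega -> R)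
    (H : set Omega) (mu : R) (w : Omega) : H w -> cond_rq X H mu w = X w.
Proof.
move=> Hw; rewrite /cond_rq !indicE mem_set// memNset; last by move=> /(_ Hw).
by rewrite mulr1 mulr0 addr0.
Qed.

Lemma cond_rq_out (R : realType) (Omega : Type) (X : Omega -> R)
    (H : set Omega) (mu : R) (w : Omega) : ~ H w -> cond_rq X H mu w = mu.
Proof.
move=> nHw; rewrite /cond_rq !indicE memNset// mem_set//.
by rewrite mulr1 mulr0 add0r.
Qed.

Lemma indic_setC (R : realType) (Omega : Type) (A : set Omega) (w : Omega) :
  \1_(~` A) w = 1 - \1_A w :> R.
Proof. by rewrite !indicE in_setC; case: (_ \in _); rewrite ?subr0 ?subrr. Qed.

Lemma cond_eventC (R : realType) (Omega : Type) (A H : set Omega) (x : R)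
    (w : Omega) :
  cond_event (~` A) H (1 - x) w = 1 - cond_event A H x w.
Proof.
rewrite /cond_event; have [Hw|nHw] := pselect (H w).
  by rewrite !cond_rq_in// indic_setC.
by rewrite !cond_rq_out.
Qed.

Lemma indic_itv (R : realType) (Omega : Type) (A : set Omega) (w : Omega) :
  0 <= (\1_A w : R) <= 1.
Proof. by rewrite indicE; case: (_ \in _); rewrite /= !lexx ?ler01. Qed.

Lemma cond_event_itv (R : realType) (Omega : Type) (A H : set Omega) (x : R)
    (w : Omega) : 0 <= x <= 1 -> 0 <= cond_event A H x w <= 1.
Proof.
rewrite /cond_event; have [Hw|nHw] := pselect (H w).
  by rewrite cond_rq_in// indic_itv.
by rewrite cond_rq_out.
Qed.

Lemma cond_event_bool (R : realType) (Omega : Type) (A H : set Omega) (x : R)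
    (w : Omega) : H w -> cond_event A H x w = 0 \/ cond_event A H x w = 1.
Proof.
move=> Hw; rewrite /cond_event cond_rq_in// indicE.
by case: (_ \in _); [right|left].
Qed.

(** The minimum is the product when one argument is 0 or 1 and the other lies
    in [0, 1], so the two terms are [a * b] and [(1 - a) * b].  The identity
    fails for [a] and [b] both in the open interval. *)
Lemma minr_split (R : realType) (a b : R) :
  0 <= a <= 1 -> 0 <= b <= 1 -> a = 0 \/ a = 1 \/ b = 0 \/ b = 1 ->
  Num.min a b + Num.min (1 - a) b = b.
Proof.
move=> /andP[a0 a1] /andP[b0 b1] ab; case: (leP a b); case: (leP (1 - a) b);
  by case: ab => [|[|[|]]] ->; lra.
Qed.

Lemma min_rq_split (R : realType) (Omega : Type) (A H B K : set Omega)
    (x y : R) (w : Omega) :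
  0 <= x <= 1 -> 0 <= y <= 1 -> (H `|` K) w ->
  min_rq A H x B K y w + min_rq (~` A) H (1 - x) B K y w = cond_event B K y w.
Proof.
move=> x01 y01 HKw; rewrite /min_rq cond_eventC.
apply: minr_split; [exact: cond_event_itv|exact: cond_event_itv|].
case: HKw => [Hw|Kw].
  by case: (cond_event_bool A x Hw); tauto.
by case: (cond_event_bool B y Kw); tauto.
Qed.

(** * Consequences of coherence *)

Lemma coherent_gain (R : realType) (Omega : Type) (n : nat)
    (X : 'I_n -> Omega -> R) (H : 'I_n -> set Omega) (mu : 'I_n -> R)
    (J : {set 'I_n}) (s : 'I_n -> R) :
  coherent X H mu -> (exists i, i \in J) ->
  (exists2 w, (\bigcup_(i in [set` J]) H i) w & gain X H mu J s w <= 0) /\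
  (exists2 w, (\bigcup_(i in [set` J]) H i) w & 0 <= gain X H mu J s w).
Proof.
move=> coh J0; have [m [M [[[u Uu um] _] [[v Uv vM] _]]]] := coh J s J0.
by move=> /andP[m0 M0]; split; [exists u|exists v]; rewrite // ?um ?vM.
Qed.

(** No sure gain or sure loss: a bet with a constant outcome must be worth
    nothing. *)
Lemma coherent_cst_gain (R : realType) (Omega : Type) (n : nat)
    (X : 'I_n -> Omega -> R) (H : 'I_n -> set Omega) (mu : 'I_n -> R)
    (J : {set 'I_n}) (s : 'I_n -> R) (c : R) :
  coherent X H mu -> (exists i, i \in J) ->
  (forall w, (\bigcup_(i in [set` J]) H i) w -> gain X H mu J s w = c) ->
  c = 0.
Proof.
move=> coh J0 gc; have [[u Uu gu] [v Uv gv]] := coherent_gain s coh J0.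
by apply/le_anti; rewrite -{1}(gc u Uu) gu -(gc v Uv) gv.
Qed.

(** A unit bet on the conditional event alone gains [\1_A - mu i] on its
    conditioning event, which is a sure gain for [mu i < 0] and a sure loss for
    [mu i > 1]. *)
Lemma coherent_prob_itv (R : realType) (Omega : Type) (n : nat)
    (X : 'I_n -> Omega -> R) (H : 'I_n -> set Omega) (mu : 'I_n -> R)
    (i : 'I_n) (A : set Omega) :
  coherent X H mu -> X i = \1_A -> 0 <= mu i <= 1.
Proof.
move=> coh XA.
have gE w : (\bigcup_(j in [set` [set i]%SET]) H j) w ->
    gain X H mu [set i]%SET (fun=> 1) w = \1_A w - mu i.
  move=> [j /= /finset.set1P -> Hw].
  by rewrite /gain finset.big_set1 XA [\1_(H i) w]indicE mem_set// !mul1r.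
have J0 : exists j, j \in [set i]%SET by exists i; rewrite finset.set11.
have [[u Uu gu] [v Uv gv]] := coherent_gain (fun=> 1) coh J0.
move: gu gv; rewrite !gE// subr_le0 subr_ge0 => gu gv.
have /andP[u0 _] := indic_itv R A u; have /andP[_ v1] := indic_itv R A v.
by rewrite (le_trans u0 gu) (le_trans gv v1).
Qed.

(** * Decomposition of a conditional event *)

Theorem proposition1 (R : realType) (Omega : Type) (A H B K : set Omega)
    (x y z1 z2 : R)
    (H_neq0 : H !=set0) (K_neq0 : K !=set0)
    (coh : coherent
       (tnth [tuple \1_A; \1_B;
                    min_rq A H x B K y; min_rq (~` A) H (1 - x) B K y])
       (tnth [tuple H; K; H `|` K; H `|` K])
       (tnth [tuple x; y; z1; z2])) :
  forall w : Omega,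
    cond_event B K y w
    = conj_rq A H x B K y z1 w + conj_rq (~` A) H (1 - x) B K y z2 w.
Proof.
have x01 : 0 <= x <= 1.
  exact: (coherent_prob_itv (i := ord0) coh (erefl _)).
have y01 : 0 <= y <= 1.
  exact: (coherent_prob_itv (i := lift ord0 ord0) coh (erefl _)).
have yz : y = z1 + z2.
  apply: subr0_eq.
  (* The stake 0 on [A|H] lets the bet range over the whole assessment: the
     union of the conditioning events is [H `|` K] with or without it. *)
  apply: (coherent_cst_gain (J := finset.setT)
    (s := tnth [tuple 0; -1; 1; 1]) coh).
    by exists ord0; rewrite finset.in_setT.
  move=> w [i _ Uw].
  have HKw : (H `|` K) w.
    by case: i Uw => [[|[|[|[|//]]]] ?]; rewrite (tnth_nth set0) /setU /=; tauto.
  rewrite /gain (eq_bigl xpredT); last by move=> j; rewrite finset.in_setT.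
  rewrite !big_ord_recl big_ord0 !tnthS !tnth0 [\1_(_ `|` _) w]indicE mem_set//.
  have := min_rq_split A B x01 y01 HKw.
  by rewrite /cond_event /cond_rq indic_setC /=; lra.
move=> w; rewrite /conj_rq; have [HKw|nHKw] := pselect ((H `|` K) w).
  by rewrite !cond_rq_in// min_rq_split.
rewrite /cond_event !cond_rq_out//.
by move=> Kw; apply: nHKw; right.
Qed.
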